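(* Let $D\in\mathbb{C}^{n\times n}$ be a diagonal matrix with distinct diagonal entries $\lambda_1,\dots,\lambda_n$. Let $E\in\mathbb{C}^{n\times n}$ have zero diagonal, and let $B\in\mathbb{C}^{n\times n}$ be the matrix with zero diagonal such that $E=DB-BD$. Fix $i$, put $\eta_i=\min_{j\neq i}|\lambda_i-\lambda_j|$ and $\rho_i=\|E\|/\eta_i$, and assume $\rho_i<1/3$. For $t\in[0,1]$ let $\lambda_i(t)$ be the eigenvalue of $D+tE$ that is the perturbation of $\lambda_i$. Then for all $t\in[0,1]$ $$|\lambda_i(t)-\lambda_i| \le \frac{t^2\|E\|\,\frac{\|B(i,:)\|+\|B(:,i)\|}{2}+\frac{t^3\|E\|\,\|B(i,:)\|\,\|B(:,i)\|}{3\left(1-\frac{2\|E\|}{\eta_i}\right)}}{1-\frac{2\|E\|}{\eta_i}-\frac{\|B(i,:)\|\,\|B(:,i)\|}{1-\frac{2\|E\|}{\eta_i}}} \le \frac{t^2\|E\|\left(\rho_i+\frac{t}{3}\,\frac{\rho_i^2}{1-2\rho_i}\right)}{1-2\rho_i-\frac{\rho_i^2}{1-2\rho_i}}.$$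
   Context: $\|\cdot\|$ is the spectral norm for matrices and the Euclidean norm for vectors; $M(:,i)$ and $M(i,:)$ denote the $i$-th column and $i$-th row of a matrix $M$. For $i\ne j$ the matrix $B$ has entries $B(i,j)=E(i,j)/(\lambda_i-\lambda_j)$. The function $\lambda_i(t)$ is the continuous eigenvalue branch of $D+tE$ with $\lambda_i(0)=\lambda_i$. *)

(* Defs.v *)
From mathcomp Require Export all_boot all_order all_algebra.
From mathcomp Require Export all_classical all_reals all_analysis complex.
Export Order.TTheory GRing.Theory Num.Theory numFieldNormedType.Exports.

Set Implicit Arguments.
Unset Strict Implicit.
Unset Printing Implicit Defensive.

Local Open Scope classical_set_scope.
Local Open Scope complex_scope.
Local Open Scope ring_scope.

(* The modulus as an element of R; the norm `|z| of the numFieldType R[i]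
   lives in R[i] itself. *)
Definition cmod (R : realType) (z : R[i]) : R := ComplexField.Normc.normc z.

Definition enorm (R : realType) (n : nat) (x : 'cV[R[i]]_n) : R :=
  Num.sqrt (\sum_(k < n) cmod (x k 0) ^+ 2).

(* The library norm on matrices is the maximum norm of the entries, so the
   operator norm induced by the Euclidean norm is defined here. *)
Definition spectral_norm (R : realType) (m n : nat) (M : 'M[R[i]]_(m, n)) : R :=
  sup [set enorm (M *m x) | x in [set x : 'cV[R[i]]_n | enorm x <= 1]].

(* The infimum is over a finite set, hence a minimum as soon as 1 < n
   (see eig_gapP).  For n = 1 it is inf set0 = 0, and then a quotient
   x / eig_gap lambda i is 0, as with the convention min set0 = +oo. *)
Definition eig_gap (R : realType) (n : nat) (lambda : 'rV[R[i]]_n) (i : 'I_n)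
  : R :=
  inf [set cmod (lambda 0 i - lambda 0 j) | j in [set j : 'I_n | j != i]].

(* The ascription to numFieldType selects the topology of the modulus on R[i]. *)
Definition eigenvalue_branch (R : realType) (n : nat) (D E : 'M[R[i]]_n)
    (lam0 : R[i]) (lam : R -> R[i]) : Prop :=
  [/\ {within `[0, 1], continuous (lam : R -> (R[i] : numFieldType))},
      lam 0 = lam0
    & forall t : R, t \in `[0, 1] -> eigenvalue (D + t%:C *: E) (lam t)].

Lemma cmod_ge0 (R : realType) (z : R[i]) : 0 <= cmod z.
Proof. by case: z => a b; exact: sqrtr_ge0. Qed.

Lemma eig_gapP (R : realType) (n : nat) (lambda : 'rV[R[i]]_n) (i : 'I_n) :
  (1 < n)%N ->
  (exists2 j, j != i & eig_gap lambda i = cmod (lambda 0 i - lambda 0 j)) /\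
  (forall j, j != i -> eig_gap lambda i <= cmod (lambda 0 i - lambda 0 j)).
Proof.
move=> n1.
pose F j := cmod (lambda 0 i - lambda 0 j).
have [j0 j0i] : exists j0 : 'I_n, j0 != i.
  have : (0 < #|predC1 i|)%N by rewrite cardC1 card_ord; case: n n1 {F lambda i} => [|[]].
  by case/card_gt0P => j0; rewrite inE; exists j0.
have lb j : j != i -> eig_gap lambda i <= F j.
  move=> ji; apply: ge_inf; last by exists j.
  by exists 0 => _ [k _ <-]; exact: cmod_ge0.
split=> //.
case: (arg_minP (P := [pred j | j != i]) F j0i) => j ji jmin.
exists j => //; apply/eqP; rewrite eq_le lb //=.
apply: lb_le_inf; first by exists (F j0), j0.
by move=> _ [k ki <-]; exact: jmin.
Qed.

Lemma spectral_norm_has_sup (R : realType) (m n : nat) (M : 'M[R[i]]_(m, n)) :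
  has_sup [set enorm (M *m x) | x in [set x : 'cV[R[i]]_n | enorm x <= 1]].
Proof.
split.
  exists (enorm (M *m (0 : 'cV_n))), 0 => //=.
  rewrite /enorm big1 ?sqrtr0 ?ler01 // => k _.
  by rewrite mxE /cmod ComplexField.Normc.normc0 expr0n.
exists (Num.sqrt (\sum_(k < m) (\sum_(j < n) cmod (M k j)) ^+ 2)) => _ [x x1 <-].
have xj j : cmod (x j 0) <= 1.
  apply: le_trans x1; rewrite -[leLHS]ger0_norm ?cmod_ge0// -sqrtr_sqr.
  apply: ler_wsqrtr; rewrite (bigD1 j) //= lerDl.
  by apply: sumr_ge0 => k _; exact: sqr_ge0.
apply: ler_wsqrtr; apply: ler_sum => k _.
rewrite lerXn2r ?nnegrE ?cmod_ge0//.
  by apply: sumr_ge0 => j _; exact: cmod_ge0.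
have Nsum (s : seq 'I_n) (f : 'I_n -> R[i]) :
    cmod (\sum_(j <- s) f j) <= \sum_(j <- s) cmod (f j).
  elim: s => [|a s IH]; first by rewrite !big_nil /cmod ComplexField.Normc.normc0.
  rewrite !big_cons; apply: le_trans (lerD (lexx _) IH).
  by rewrite /cmod; exact: le_normcD.
rewrite mxE; apply: le_trans (Nsum _ _) _.
apply: ler_sum => j _; rewrite /cmod ComplexField.Normc.normcM.
by apply: ler_piMr; [exact: cmod_ge0 | exact: xj].
Qed.

(* Main.v *)
(* No differentiation of the branch is needed.  Let [d = mu - lambda_i] for
   [mu = lambda_i(t)].  Bauer-Fike and continuity of the branch give
   [|d| <= t |E|].  For a right eigenvector [x] of [D + t E], let [w] be [x] with
   its [i]-th entry removed.  The [i]-th row of the eigenvalue equation reads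
   [d x_i = t (E w)_i], and the other rows, divided by [lambda_j - lambda_i], give
   [|w| <= t |x_i| |B(:,i)| + 2 t (|E| / eta) |w|].  Therefore
   [|d| (1 - 2 rho) <= t^2 |E| |B(:,i)|], and the transposed matrices give the same
   with [B(i,:)].  The mean of the two is already stronger than the first bound
   of the theorem; the second follows from [|B(:,i)|, |B(i,:)| <= rho]. *)
Require Import Defs.
From mathcomp Require Import ring lra.

Local Open Scope classical_set_scope.
Local Open Scope complex_scope.
Local Open Scope ring_scope.

(** * The complex modulus with values in [R] *)

Section Modulus.
Set Implicit Arguments.
Unset Strict Implicit.
Variable R : realType.
Implicit Types z w : R[i].

Lemma cmod0 : cmod (0 : R[i]) = 0.
Proof. exact: ComplexField.Normc.normc0. Qed.

Lemma cmod0_eq0 z : cmod z = 0 -> z = 0.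
Proof. exact: ComplexField.Normc.eq0_normc. Qed.

Lemma cmodM z w : cmod (z * w) = cmod z * cmod w.
Proof. exact: ComplexField.Normc.normcM. Qed.

Lemma cmodN z : cmod (- z) = cmod z.
Proof. exact: normcN. Qed.

Lemma cmodB z w : cmod (z - w) = cmod (w - z).
Proof. by rewrite -cmodN opprB. Qed.

Lemma ler_cmodD z w : cmod (z + w) <= cmod z + cmod w.
Proof. exact: le_normcD. Qed.

Lemma cmod_real (t : R) : 0 <= t -> cmod t%:C = t.
Proof. by move=> t0; rewrite /cmod /= expr0n /= addr0 sqrtr_sqr ger0_norm. Qed.

Lemma cmod_conj z : cmod (z^*)%C = cmod z.
Proof. by case: z => a b; rewrite /cmod /= sqrrN. Qed.

Lemma mul_conj_cmod z : z * (z^*)%C = (cmod z ^+ 2)%:C.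
Proof. by rewrite -sqr_normc normc_def rmorphXn; case: z. Qed.

Lemma ler_cmod_sum (I : Type) (s : seq I) (P : pred I) (F : I -> R[i]) :
  cmod (\sum_(k <- s | P k) F k) <= \sum_(k <- s | P k) cmod (F k).
Proof.
elim/big_rec2: _ => [|k x y _ IH]; first by rewrite cmod0.
by apply: le_trans (ler_cmodD _ _) _; rewrite lerD2l.
Qed.

End Modulus.

(** * Cauchy-Schwarz, the Euclidean norm and the spectral norm *)

Section EuclideanNorm.
Set Implicit Arguments.
Unset Strict Implicit.
Variable R : realType.
Local Notation C := R[i].

(** Cauchy-Schwarz: with [a], [b] the two norms, the sum of the squares [(b f - a g)^2] expands to
    [2 a b (a b - sum f g) >= 0]. If a norm is zero, all products vanish. *)
Lemma sum_mul_le (n : nat) (f g : 'I_n -> R) :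
  \sum_k f k * g k
    <= Num.sqrt (\sum_k f k ^+ 2) * Num.sqrt (\sum_k g k ^+ 2).
Proof.
have ge0 (h : 'I_n -> R) : 0 <= \sum_k h k ^+ 2.
  by apply: sumr_ge0 => k _; exact: sqr_ge0.
have sq (h : 'I_n -> R) : Num.sqrt (\sum_k h k ^+ 2) ^+ 2 = \sum_k h k ^+ 2.
  by rewrite sqr_sqrtr.
have eq0 (h : 'I_n -> R) : Num.sqrt (\sum_k h k ^+ 2) = 0 -> forall k, h k = 0.
  move=> h0 k; move: (sq h); rewrite h0 expr0n /= => /esym s0; apply/eqP.
  rewrite -sqrf_eq0; apply/eqP.
  by apply: (psumr_eq0P _ s0) => // j _; exact: sqr_ge0.
move: (sq f) (sq g) (eq0 f) (eq0 g) (sqrtr_ge0 (\sum_k f k ^+ 2))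
  (sqrtr_ge0 (\sum_k g k ^+ 2)).
set a := Num.sqrt _; set b := Num.sqrt (\sum_k g k ^+ 2).
move=> sa sb a0 b0 age bge.
have [fa|an0] := eqVneq a 0.
  by rewrite fa mul0r big1 // => k _; rewrite a0 // mul0r.
have [fb|bn0] := eqVneq b 0.
  by rewrite fb mulr0 big1 // => k _; rewrite b0 // mulr0.
have ab0 : 0 < a * b by rewrite mulr_gt0 // lt0r ?an0 ?bn0.
rewrite -(ler_pM2l ab0).
have : 0 <= \sum_k (b * f k - a * g k) ^+ 2.
  by apply: sumr_ge0 => k _; exact: sqr_ge0.
have -> : \sum_k (b * f k - a * g k) ^+ 2
    = \sum_k (b ^+ 2 * f k ^+ 2 + (a ^+ 2 * g k ^+ 2
                                    + - (2 * (a * b)) * (f k * g k))).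
  by apply: eq_bigr => k _; ring.
rewrite !big_split /= -!mulr_sumr -sa -sb; nra.
Qed.

Lemma enorm_ge0 n (x : 'cV[C]_n) : 0 <= enorm x.
Proof. exact: sqrtr_ge0. Qed.

Lemma sqr_enorm n (x : 'cV[C]_n) : enorm x ^+ 2 = \sum_k cmod (x k 0) ^+ 2.
Proof. by rewrite sqr_sqrtr //; apply: sumr_ge0 => k _; exact: sqr_ge0. Qed.

Lemma ler_enorm n (x y : 'cV[C]_n) :
  (forall k, cmod (x k 0) <= cmod (y k 0)) -> enorm x <= enorm y.
Proof.
move=> xy; apply: ler_wsqrtr; apply: ler_sum => k _.
by rewrite lerXn2r ?nnegrE ?cmod_ge0.
Qed.

Lemma eq_enorm n (x y : 'cV[C]_n) :
  (forall k, cmod (x k 0) = cmod (y k 0)) -> enorm x = enorm y.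
Proof. by move=> xy; apply/eqP; rewrite eq_le !ler_enorm // => k; rewrite xy. Qed.

Lemma ler_enorm_entry n (x : 'cV[C]_n) k : cmod (x k 0) <= enorm x.
Proof.
rewrite -[leLHS]ger0_norm ?cmod_ge0// -sqrtr_sqr.
apply: ler_wsqrtr; rewrite (bigD1 k) //= lerDl.
by apply: sumr_ge0 => j _; exact: sqr_ge0.
Qed.

Lemma enorm0_eq0 n (x : 'cV[C]_n) : enorm x = 0 -> x = 0.
Proof.
move=> x0; apply/colP => k; rewrite mxE; apply: cmod0_eq0.
by apply/eqP; rewrite eq_le cmod_ge0 -x0 ler_enorm_entry.
Qed.

Lemma enorm0 n : enorm (0 : 'cV[C]_n) = 0.
Proof. by rewrite /enorm big1 ?sqrtr0 // => k _; rewrite mxE cmod0 expr0n. Qed.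

Lemma enormZ n (a : C) (x : 'cV[C]_n) : enorm (a *: x) = cmod a * enorm x.
Proof.
rewrite /enorm -[cmod a]ger0_norm ?cmod_ge0 // -sqrtr_sqr -sqrtrM ?sqr_ge0 //.
by rewrite mulr_sumr; congr Num.sqrt; apply: eq_bigr => k _;
  rewrite mxE cmodM exprMn.
Qed.

Lemma enormD n (x y : 'cV[C]_n) : enorm (x + y) <= enorm x + enorm y.
Proof.
rewrite -(@ler_pXn2r _ 2) ?nnegrE ?addr_ge0 ?enorm_ge0 // sqrrD !sqr_enorm.
have := sum_mul_le (fun k => cmod (x k 0)) (fun k => cmod (y k 0)).
rewrite -/(enorm x) -/(enorm y) => xy.
have : \sum_k cmod ((x + y) k 0) ^+ 2 <= \sum_k cmod (x k 0) ^+ 2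
   + (\sum_k cmod (y k 0) ^+ 2 + 2 * \sum_k cmod (x k 0) * cmod (y k 0)).
  rewrite mulr_sumr -!big_split /=; apply: ler_sum => k _; rewrite mxE.
  have := ler_cmodD (x k 0) (y k 0); have := cmod_ge0 (x k 0 + y k 0); nra.
lra.
Qed.

Lemma enorm_mulmx m n (M : 'M[C]_(m, n)) (x : 'cV[C]_n) :
  enorm (M *m x) <= spectral_norm M * enorm x.
Proof.
have [/enorm0_eq0 ->|x0] := eqVneq (enorm x) 0.
  by rewrite mulmx0 !enorm0 mulr0.
have xgt0 : 0 < enorm x by rewrite lt0r x0 enorm_ge0.
rewrite -ler_pdivrMr //.
have -> : enorm (M *m x) / enorm x = enorm (M *m ((enorm x)^-1%:C *: x)).
  by rewrite -scalemxAr enormZ cmod_real ?invr_ge0 ?enorm_ge0 // mulrC.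
apply: sup_upper_bound; first exact: spectral_norm_has_sup.
exists ((enorm x)^-1%:C *: x) => //=.
by rewrite enormZ cmod_real ?invr_ge0 ?enorm_ge0 // mulVf.
Qed.

Lemma spectral_norm_ge0 m n (M : 'M[C]_(m, n)) : 0 <= spectral_norm M.
Proof.
apply: sup_upper_bound; first exact: spectral_norm_has_sup.
by exists 0; rewrite ?mulmx0 /= ?enorm0.
Qed.

Lemma enorm_col m n (M : 'M[C]_(m, n)) j : enorm (col j M) <= spectral_norm M.
Proof.
rewrite colE; apply: le_trans (enorm_mulmx _ _) _.
rewrite -[leRHS]mulr1 ler_wpM2l ?spectral_norm_ge0 // -[leRHS]sqrtr1.
apply: ler_wsqrtr; rewrite (bigD1 j) //= mxE !eqxx.
by rewrite cmod_real // expr1n big1 ?addr0 // => k kj;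
  rewrite mxE (negbTE kj) cmod0 expr0n.
Qed.

(* With [w = M^T x], [|w|^2 = x^T M conj(w)], to which Cauchy-Schwarz applies. *)
Lemma spectral_norm_tr_le m n (M : 'M[C]_(m, n)) :
  spectral_norm M^T <= spectral_norm M.
Proof.
have [] := spectral_norm_has_sup M^T => ne _.
apply: ge_sup => // _ [x x1 <-]; set w := M^T *m x.
have [->|w0] := eqVneq (enorm w) 0; first exact: spectral_norm_ge0.
have wgt0 : 0 < enorm w by rewrite lt0r w0 enorm_ge0.
pose v : 'cV_n := map_mx conjc w.
have vw : enorm v = enorm w.
  by apply: eq_enorm => k; rewrite mxE cmod_conj.
rewrite -(ler_pM2r wgt0) -expr2 -{2}vw.
have -> : enorm w ^+ 2 = cmod (\sum_k x k 0 * (M *m v) k 0).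
  have -> : \sum_k x k 0 * (M *m v) k 0 = (x^T *m (M *m v)) 0 0.
    by rewrite !mxE; apply: eq_bigr => k _; rewrite [x^T _ _]mxE.
  rewrite mulmxA -[x^T *m M]trmxK trmx_mul trmxK -/w mxE.
  rewrite (_ : \sum_j _ = (enorm w ^+ 2)%:C) ?cmod_real ?sqr_ge0 //.
  rewrite sqr_enorm rmorph_sum; apply: eq_bigr => k _.
  by rewrite !mxE mul_conj_cmod.
apply: le_trans (ler_cmod_sum _ _ _) _.
under eq_bigr do rewrite cmodM.
apply: le_trans (sum_mul_le _ _) _; rewrite -/(enorm x) -/(enorm (M *m v)).
apply: le_trans (enorm_mulmx _ _).
by rewrite -[leRHS]mul1r ler_wpM2r ?enorm_ge0.
Qed.

Lemma spectral_norm_tr m n (M : 'M[C]_(m, n)) :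
  spectral_norm M^T = spectral_norm M.
Proof.
apply/eqP; rewrite eq_le spectral_norm_tr_le /=.
by have := spectral_norm_tr_le M^T; rewrite trmxK.
Qed.

End EuclideanNorm.

(** [A - a] and its transpose have equal rank, hence kernels of equal dimension. This gives right
    eigenvectors, and later the passage from columns to rows of [B]. *)
Lemma eigenvalue_tr (F : fieldType) n (A : 'M[F]_n) (a : F) :
  eigenvalue A^T a = eigenvalue A a.
Proof.
by rewrite /eigenvalue /eigenspace -!mxrank_eq0 !mxrank_ker
  -[in RHS]mxrank_tr linearB /= tr_scalar_mx.
Qed.

(** * Location and shift of the eigenvalues of a perturbed diagonal matrix *)

Section Perturbation.
Set Implicit Arguments.
Unset Strict Implicit.
Variables (R : realType) (n : nat) (lambda : 'rV[R[i]]_n) (i : 'I_n).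

(** [eigenvalue] speaks of row eigenvectors; transposing twice yields a column one. *)
Lemma eigenvalue_tr_col (E : 'M[R[i]]_n) (t : R) (mu : R[i]) :
  eigenvalue (diag_mx lambda + t%:C *: E) mu ->
  exists2 x : 'cV[R[i]]_n, x != 0 &
    forall j, (mu - lambda 0 j) * x j 0 = t%:C * (E *m x) j 0.
Proof.
rewrite -eigenvalue_tr => /eigenvalueP[v vE v0].
exists v^T => [|j]; first by rewrite -trmx0 (inj_eq (@trmx_inj _ _ _)).
have {}vE : (diag_mx lambda + t%:C *: E) *m v^T = mu *: v^T.
  by rewrite -[_ + _]trmxK -trmx_mul vE linearZ.
move: vE; rewrite mulmxDl -scalemxAl => /colP/(_ j).
rewrite mul_diag_mx [LHS]mxE [in X in X + _]mxE [in X in _ + X]mxE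
  [RHS]mxE => h.
by rewrite mulrBl -h addrAC subrr add0r.
Qed.

(** Bauer-Fike for a diagonal matrix: for the [lambda_j] nearest to [mu], [|mu - lambda_j| |x| <=
    |(mu - D) x| = t |E x|]. *)
Lemma diag_perturbation_disc (E : 'M[R[i]]_n) (t : R) (mu : R[i]) :
  0 <= t -> eigenvalue (diag_mx lambda + t%:C *: E) mu ->
  exists j, cmod (mu - lambda 0 j) <= t * spectral_norm E.
Proof.
move=> t0 /eigenvalue_tr_col[x x0 xE].
have xgt0 : 0 < enorm x.
  by rewrite lt0r enorm_ge0 andbT; apply: contra x0 => /eqP/enorm0_eq0 ->.
case: (arg_minP (P := predT) (fun j => cmod (mu - lambda 0 j)) (erefl : predT i)).
move=> j _ jmin; exists j; rewrite -(ler_pM2r xgt0).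
rewrite -[cmod _]cmod_real ?cmod_ge0 // -enormZ -mulrA.
apply: le_trans (ler_wpM2l t0 (enorm_mulmx E x)).
rewrite -{1}(cmod_real t0) -enormZ; apply: ler_enorm => k.
rewrite 2![(_ *: _ : 'cV_n) k 0]mxE -xE !cmodM cmod_real ?cmod_ge0 //.
by rewrite ler_wpM2r ?cmod_ge0 ?jmin.
Qed.

(** The core estimate, multiplied through by [eta]. Applied to [E^T] and [- B^T] it yields the row
    version. *)
Lemma eigenvalue_shift_col (E B : 'M[R[i]]_n) (eta t : R) (mu : R[i]) :
  let nE := spectral_norm E in
  (forall j, j != i -> eta <= cmod (lambda 0 i - lambda 0 j)) ->
  (forall j, E j i = (lambda 0 j - lambda 0 i) * B j i) ->
  B i i = 0 -> 0 <= t -> 2 * t * nE < eta ->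
  cmod (mu - lambda 0 i) <= t * nE ->
  eigenvalue (diag_mx lambda + t%:C *: E) mu ->
  cmod (mu - lambda 0 i) * (eta - 2 * t * nE)
    <= t ^+ 2 * nE * eta * enorm (col i B).
Proof.
move=> nE gap EB Bii t0 tE dE /eigenvalue_tr_col[x x0 xE].
set d := mu - lambda 0 i in dE *.
have nE0 : 0 <= nE by exact: spectral_norm_ge0.
have eta0 : 0 < eta by apply: le_lt_trans tE; rewrite !mulr_ge0.
(* [u_i = 0], and [(lambda_j - lambda_i) u_j = (mu - lambda_i) w_j - t (E w)_j]
   for [j <> i]; hence [eta |u| <= 2 t |E| |w|]. *)
pose w : 'cV_n := \col_j (if j == i then 0 else x j 0).
pose u := w + (t%:C * x i 0) *: col i B.
(* Splitting off the [i]-th component isolates column [i] of [E], the source of [B(:,i)]. *)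
have Ex : E *m x = E *m w + x i 0 *: col i E.
  have -> : x = w + x i 0 *: delta_mx i 0.
    apply/colP => j; rewrite !mxE eqxx andbT; case: eqP => [->|_].
      by rewrite mulr1 add0r.
    by rewrite mulr0 addr0.
  rewrite mulmxDr -scalemxAr -colE; congr (_ + _ *: _).
  by rewrite !mxE !eqxx mulr1 add0r.
have Eii : E i i = 0 by rewrite EB subrr mul0r.
have uw : eta * enorm u <= 2 * t * nE * enorm w.
  rewrite -{1}(cmod_real (ltW eta0)) -enormZ.
  apply: (@le_trans _ _ (enorm (d *: w - t%:C *: (E *m w)))).
    apply: ler_enorm => j; rewrite mxE cmodM (cmod_real (ltW eta0)).
    have [->|ji] := eqVneq j i.
      rewrite (_ : u i 0 = 0) ?cmod0 ?mulr0 ?cmod_ge0 //.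
      by rewrite !mxE eqxx Bii mulr0 addr0.
    apply: le_trans (ler_wpM2r (cmod_ge0 _) (gap j ji)) _.
    rewrite cmodB -cmodM le_eqVlt; apply/orP; left; apply/eqP; congr cmod.
    have := xE j; rewrite Ex.
    rewrite [(_ + _ : 'cV_n) j 0]mxE [(_ *: col i E) j 0]mxE [col i E j 0]mxE EB.
    rewrite ![(_ + _ : 'cV_n) j 0]mxE [(- _ : 'cV_n) j 0]mxE.
    rewrite ![(_ *: _ : 'cV_n) j 0]mxE [col i B j 0]mxE [w j 0]mxE (negbTE ji) /d.
    move: ((E *m w) j 0) => e h.
    have -> : t%:C * e = (mu - lambda 0 j) * x j 0
        - t%:C * (x i 0 * ((lambda 0 j - lambda 0 i) * B j i)).
      by rewrite h; ring.
    by ring.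
  (* Each term costs [t * nE * enorm w]: the first by [dE], the second by the spectral norm. Hence
     the factor 2. *)
  apply: le_trans (enormD _ _) _.
  rewrite -scaleNr !enormZ cmodN cmod_real //.
  have := ler_wpM2r (enorm_ge0 w) dE.
  have := ler_wpM2l t0 (enorm_mulmx E w); rewrite -/nE.
  lra.
have wu : enorm w <= enorm u + t * cmod (x i 0) * enorm (col i B).
  have -> : w = u + (- (t%:C * x i 0)) *: col i B.
    by rewrite /u scaleNr addrK.
  apply: le_trans (enormD _ _) _.
  by rewrite enormZ cmodN cmodM cmod_real.
have wx : (eta - 2 * t * nE) * enorm w
    <= eta * (t * cmod (x i 0) * enorm (col i B)).
  have := ler_wpM2l (ltW eta0) wu; lra.
have gap0 : 0 < eta - 2 * t * nE by lra.
(* If [x i 0 = 0], then [wx] forces [w = 0], so [x = 0]. *)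
have xi0 : 0 < cmod (x i 0).
  rewrite lt0r cmod_ge0 andbT; apply: contra x0 => /eqP xi0.
  have w0 : w = 0.
    apply: enorm0_eq0; apply/eqP; rewrite eq_le enorm_ge0 andbT.
    rewrite -(ler_pM2l gap0) mulr0; apply: le_trans wx _.
    by rewrite xi0 !(mulr0, mul0r).
  apply/eqP/colP => j; rewrite mxE; have [->|ji] := eqVneq j i.
    exact: cmod0_eq0.
  by have := congr1 (fun v : 'cV_n => v j 0) w0; rewrite !mxE (negbTE ji).
have dx : cmod d * cmod (x i 0) <= t * (nE * enorm w).
  rewrite -cmodM xE Ex [(_ + _ : 'cV_n) i 0]mxE [(_ *: col i E) i 0]mxE.
  rewrite [col i E i 0]mxE Eii mulr0 addr0 cmodM cmod_real // ler_wpM2l //.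
  exact: le_trans (ler_enorm_entry _ _) (enorm_mulmx _ _).
(* Chain [dx], scaled by [eta - 2 t nE], with [wx], scaled by [t nE]; the factor [|x_i|] cancels. *)
rewrite -(ler_pM2r xi0).
have := ler_wpM2l (ltW gap0) dx.
have := ler_wpM2l (mulr_ge0 t0 nE0) wx.
lra.
Qed.

(** Reverse triangle inequality. Distances in [R[i]] are themselves elements of [R[i]], so the
    tolerance is [e%:C]. *)
Lemma continuous_within_cmod (A : set R) (f : R -> R[i]) (c : R[i]) :
  {within A, continuous (f : R -> (R[i] : numFieldType))} ->
  {within A, continuous (fun t => cmod (f t - c))}.
Proof.
move=> fc t; apply/cvgrPdist_lt => e e0.
have := fc t; rewrite /continuous_at => /cvgrPdist_lt/(_ e%:C).
rewrite ltcR => /(_ e0); apply: filterS => s.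
rewrite normc_def => h.
have {}h : cmod (f t - f s) < e.
  by move: h; rewrite /cmod; case: (f t - f s) => a b /=; rewrite ltcR.
apply: le_lt_trans h; rewrite ler_norml.
have := ler_cmodD (f t - f s) (f s - c); have := ler_cmodD (f s - f t) (f t - c).
rewrite !subrKA (cmodB (f s)) /from_subspace.
by move=> h1 h2; apply/andP; split; lra.
Qed.

(* Every eigenvalue lies within [|E|] of some [lambda_j]; as [2 |E| < eta], a
   branch leaving the disc about [lambda_i] would have to cross the circle of
   radius [eta / 2], which no disc meets. *)
Lemma eigenvalue_branch_disc (E : 'M[R[i]]_n) (eta : R) (lam : R -> R[i]) :
  let nE := spectral_norm E in
  0 < eta -> 2 * nE < eta ->
  (forall j, j != i -> eta <= cmod (lambda 0 i - lambda 0 j)) ->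
  eigenvalue_branch (diag_mx lambda) E (lambda 0 i) lam ->
  forall t, t \in `[0, 1] -> cmod (lam t - lambda 0 i) <= t * nE.
Proof.
move=> nE eta0 nEeta gap [lamc lam0 lamE] t t01.
have nE0 : 0 <= nE by exact: spectral_norm_ge0.
(* If the disc containing [lam s] is centred at another [lambda_j], the triangle inequality keeps
   [lam s] at distance at least [eta - nE > eta / 2] from [lambda_i]. *)
have alt s : s \in `[0, 1] -> cmod (lam s - lambda 0 i) <= s * nE
    \/ eta - nE <= cmod (lam s - lambda 0 i).
  move=> s01; have /andP[s0 s1] : 0 <= s <= 1 by rewrite in_itv in s01.
  have [j] := diag_perturbation_disc s0 (lamE s s01); rewrite -/nE.
  have [->|ji] := eqVneq j i; first by left.
  have := gap j ji; have := ler_cmodD (lambda 0 i - lam s) (lam s - lambda 0 j).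
  by rewrite subrKA (cmodB _ (lam s)); right; nra.
have /andP[t0 t1] : 0 <= t <= 1 by rewrite in_itv in t01.
case: (alt t t01) => // far.
have sub : `[0, t]%classic `<=` `[0 : R, 1]%classic.
  by move=> s /=; rewrite !in_itv /= => /andP[-> st]; exact: le_trans st t1.
(* The distance is 0 at time 0 and above [eta / 2] at time [t]; the value [eta / 2] taken in between
   contradicts both cases of [alt]. *)
have [||s s0t fs] := @IVT R (fun s => cmod (lam s - lambda 0 i)) 0 t (eta / 2) t0.
- apply: continuous_within_cmod; exact: continuous_subspaceW lamc.
- by rewrite lam0 subrr cmod0 min_l ?max_r ?cmod_ge0 //; lra.
have s01 : s \in `[0, 1] by apply: sub.
have /andP[s0 s1] : 0 <= s <= 1 by rewrite in_itv in s01.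
by case: (alt s s01); rewrite fs; nra.
Qed.

End Perturbation.

(** * Comparison of [B] with [rho], and the final bounds *)

Lemma enorm_col_gap (R : realType) n (lambda : 'rV[R[i]]_n) (i : 'I_n)
    (E B : 'M[R[i]]_n) (eta : R) :
  0 <= eta ->
  (forall j, j != i -> eta <= cmod (lambda 0 i - lambda 0 j)) ->
  (forall j, E j i = (lambda 0 j - lambda 0 i) * B j i) -> B i i = 0 ->
  eta * enorm (col i B) <= spectral_norm E.
Proof.
move=> eta0 gap EB Bii; apply: le_trans (enorm_col E i).
(* Entrywise, [eta |B(j,i)| <= |E(j,i)|], and a column of [E] is at most [|E|]. *)
rewrite -{1}(cmod_real eta0) -enormZ; apply: ler_enorm => j.
rewrite 3!mxE EB !cmodM (cmod_real eta0).
have [->|ji] := eqVneq j i; first by rewrite Bii cmod0 !mulr0.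
by rewrite ler_wpM2r ?cmod_ge0 // cmodB gap.
Qed.

Lemma spectral_norm0 (R : realType) m n :
  spectral_norm (0 : 'M[R[i]]_(m, n)) = 0.
Proof.
apply/eqP; rewrite eq_le spectral_norm_ge0 andbT.
have [ne _] := spectral_norm_has_sup (0 : 'M[R[i]]_(m, n)).
by apply: ge_sup => // _ [x _ <-]; rewrite mul0mx enorm0.
Qed.

(* Both denominators are positive since [r c <= p^2 < (1 - 2 p)^2], and the
   first one only decreases the bound [d (1 - 2 p) <= t^2 N (r + c) / 2]. *)
Lemma shift_bounds (R : realFieldType) (t N r c p d : R) :
  0 <= t -> 0 <= N -> 0 <= r <= p -> 0 <= c <= p -> p < 1 / 3 -> 0 <= d ->
  d * (1 - 2 * p) <= t ^+ 2 * N * r -> d * (1 - 2 * p) <= t ^+ 2 * N * c ->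
  d <= (t ^+ 2 * N * ((r + c) / 2) + t ^+ 3 * N * r * c / (3 * (1 - 2 * p)))
       / (1 - 2 * p - r * c / (1 - 2 * p))
    <= t ^+ 2 * N * (p + t / 3 * (p ^+ 2 / (1 - 2 * p)))
       / (1 - 2 * p - p ^+ 2 / (1 - 2 * p)).
Proof.
move=> t0 N0 /andP[r0 rp] /andP[c0 cp] p3 d0 dr dc.
set s := 1 - 2 * p in dr dc *.
have p0 : 0 <= p by exact: le_trans rp.
have s0 : 0 < s by rewrite /s; lra.
have rc0 : 0 <= r * c by exact: mulr_ge0.
have rcp : r * c <= p ^+ 2 by rewrite expr2; exact: ler_pM.
have rcs : r * c / s <= p ^+ 2 / s by rewrite ler_pM2r ?invr_gt0.
(* This is exactly [p < 1 / 3]; it makes [s - p ^+ 2 / s] positive. *)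
have p_lt_s : p < s by rewrite /s; lra.
have ps : 0 < s - p ^+ 2 / s.
  by rewrite subr_gt0 ltr_pdivrMr // -expr2 ltr_pXn2r // nnegrE ltW.
have T2 : 0 <= t ^+ 2 * N by rewrite mulr_ge0 ?exprn_ge0.
have T3 : 0 <= t ^+ 3 * N by rewrite mulr_ge0 ?exprn_ge0.
have num0 : 0 <= t ^+ 3 * N * r * c / (3 * s).
  by rewrite divr_ge0 ?(mulr_ge0 _ c0) ?(mulr_ge0 _ r0) // mulr_ge0 // ltW.
have rcs0 : 0 <= r * c / s by rewrite divr_ge0 // ltW.
apply/andP; split.
  rewrite ler_pdivlMr; last lra.
  apply: (@le_trans _ _ (d * s)); first by rewrite ler_wpM2l // gerBl.
  lra.
have num : t ^+ 2 * N * ((r + c) / 2) + t ^+ 3 * N * r * c / (3 * s)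
    <= t ^+ 2 * N * (p + t / 3 * (p ^+ 2 / s)).
  have -> : t ^+ 3 * N * r * c / (3 * s) = t ^+ 3 * N / 3 * (r * c / s).
    by field; exact: lt0r_neq0.
  have -> : t ^+ 2 * N * (p + t / 3 * (p ^+ 2 / s))
      = t ^+ 2 * N * p + t ^+ 3 * N / 3 * (p ^+ 2 / s).
    by field; exact: lt0r_neq0.
  apply: lerD; first by rewrite ler_wpM2l //; lra.
  by rewrite ler_wpM2l // divr_ge0.
apply: ler_pM => //.
- by rewrite addr_ge0 // mulr_ge0 // divr_ge0 // addr_ge0.
- by rewrite invr_ge0; lra.
- by rewrite lef_pV2 ?posrE; lra.
Qed.

Theorem theorem3p9 (R : realType) (n : nat) (lambda : 'rV[R[i]]_n)
    (D E B : 'M[R[i]]_n) (i : 'I_n) (lam : R -> R[i])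
    (HD : D = diag_mx lambda)
    (Hdist : injective (fun j : 'I_n => lambda 0 j))
    (HE : forall j : 'I_n, E j j = 0)
    (HB : forall j : 'I_n, B j j = 0)
    (HEB : E = D *m B - B *m D) :
  let nE := spectral_norm E in
  let eta := eig_gap lambda i in
  let rho := nE / eta in
  let nrow := enorm (row i B)^T in
  let ncol := enorm (col i B) in
  forall (Hrho : rho < 1 / 3)
    (Hlam : eigenvalue_branch D E (lambda 0 i) lam)
    (t : R) (Ht : t \in `[0, 1]),
    cmod (lam t - lambda 0 i)
      <= (t ^+ 2 * nE * ((nrow + ncol) / 2)
          + t ^+ 3 * nE * nrow * ncol / (3 * (1 - 2 * nE / eta)))
         / (1 - 2 * nE / eta - nrow * ncol / (1 - 2 * nE / eta))
      <= t ^+ 2 * nE * (rho + t / 3 * (rho ^+ 2 / (1 - 2 * rho)))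
         / (1 - 2 * rho - rho ^+ 2 / (1 - 2 * rho)).
Proof.
move=> nE eta rho nrow ncol Hrho Hlam t Ht; rewrite {}HD in HEB Hlam.
have /andP[t0 t1] : 0 <= t <= 1 by rewrite in_itv in Ht.
have eigt := let: And3 _ _ h := Hlam in h t Ht.
have nE0 : 0 <= nE by exact: spectral_norm_ge0.
(* In dimension one the zero diagonal gives [E = 0], so the shift and both bounds are 0, whatever
   the value of [eta]. *)
have [n1|n1] := leqP n 1.
  have alli j : j = i.
    have z (k : 'I_n) : k = 0 :> nat.
      by apply/eqP; rewrite -leqn0 -ltnS (leq_trans (ltn_ord k)).
    by apply: ord_inj; rewrite !z.
  have nEE : nE = 0.
    rewrite /nE (_ : E = 0) ?spectral_norm0 //; apply/matrixP => j k.
    by rewrite (alli j) (alli k) HE mxE.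
  have [j] := diag_perturbation_disc i t0 eigt.
  rewrite (alli j) -/nE {}nEE mulr0 => dt.
  by rewrite !(mulr0, mul0r) addr0 !mul0r dt lexx.
have [[j0 j0i etaj0] gap] := eig_gapP lambda i n1; rewrite -/eta in etaj0 gap.
have eta0 : 0 < eta.
  rewrite lt0r etaj0 cmod_ge0 andbT; apply: contra j0i => /eqP/cmod0_eq0/eqP.
  by rewrite subr_eq0 => /eqP/Hdist ->.
have nErho : nE = rho * eta by rewrite /rho divfK // gt_eqF.
have EB j k : E j k = (lambda 0 j - lambda 0 k) * B j k.
  rewrite HEB mul_diag_mx mul_mx_diag !mxE; ring.
have nE2 : 2 * nE < eta by nra.
have tE : 2 * t * nE < eta by nra.
have dE := eigenvalue_branch_disc eta0 nE2 gap Hlam Ht.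
(* Transposing [E = D B - B D] gives [E^T = D (- B^T) - (- B^T) D], whence the sign. *)
have rowE : nrow = enorm (col i (- B^T)).
  by apply: eq_enorm => k; rewrite !mxE cmodN.
have EBT j : E^T j i = (lambda 0 j - lambda 0 i) * (- B^T) j i.
  by rewrite !mxE EB; ring.
have BTii : (- B^T) i i = 0 by rewrite !mxE HB oppr0.
have eigtT : eigenvalue (diag_mx lambda + t%:C *: E^T) (lam t).
  by rewrite -eigenvalue_tr linearD /= linearZ /= trmxK tr_diag_mx.
(* Since [t <= 1], [eta - 2 t nE] may be lowered to [eta - 2 nE = eta (1 - 2 rho)]; then [eta]
   cancels. *)
have bound (nc : R) : 0 <= nc ->
    cmod (lam t - lambda 0 i) * (eta - 2 * t * nE) <= t ^+ 2 * nE * eta * nc ->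
    cmod (lam t - lambda 0 i) * (1 - 2 * rho) <= t ^+ 2 * nE * nc.
  move=> nc0 h; rewrite -(ler_pM2r eta0).
  have : cmod (lam t - lambda 0 i) * (2 * t * nE)
      <= cmod (lam t - lambda 0 i) * (2 * nE).
    by rewrite ler_wpM2l ?cmod_ge0 //; nra.
  by rewrite {2}nErho; lra.
have small (nc : R) : eta * nc <= nE -> nc <= rho.
  by rewrite /rho ler_pdivlMr // mulrC.
rewrite -[2 * nE / eta]mulrA -/rho; apply: shift_bounds => //.
- rewrite enorm_ge0 small // rowE /nE -spectral_norm_tr.
  exact: enorm_col_gap (ltW eta0) gap EBT BTii.
- rewrite enorm_ge0 small //.
  exact: enorm_col_gap (ltW eta0) gap (fun j => EB j i) (HB i).
- exact: cmod_ge0.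
- apply: bound; first exact: enorm_ge0.
  rewrite rowE /nE -spectral_norm_tr.
  by apply: eigenvalue_shift_col; rewrite ?spectral_norm_tr //.
- apply: bound; first exact: enorm_ge0.
  by apply: eigenvalue_shift_col; rewrite ?EB.
Qed.
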